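(* For each $n$, let $M=M^{(n)}\in\mathbb{R}^{n\times n}$ be a real symmetric matrix with spectral decomposition $M=\sum_{i=1}^n\lambda_i u_iu_i^T$, where $\lambda_1>\lambda_2>\cdots>\lambda_n$ are distinct and $u_1,\dots,u_n$ are orthonormal eigenvectors. Let $p\in(0,1)$ (possibly depending on $n$), let $Q$ be the random symmetric $n\times n$ matrix whose entries $Q_{ij}$, $i\le j$, are independent with $Q_{ij}=1/p$ with probability $p$ and $Q_{ij}=0$ otherwise, let $S=M\circ Q$ (Hadamard product) and $E=S-M$. Suppose there exist vectors $\alpha=\alpha^{(n)}\in[0,1]^n$ and an absolute constant $\mu$ such that, for all $n$, $$\mu(M,\alpha):=\sum_{i=1}^n|\lambda_i|\,n^{\alpha_i}\|u_i\|_\infty^2\le\mu\quad\text{and}\quad \mathrm{Card}(u_i)\le n^{\alpha_i},\ i=1,\dots,n,$$ where $\mathrm{Card}(u_i)$ is the number of nonzero entries of $u_i$. Let $\alpha_{\min}=\min_{1\le i\le n}\alpha_i$. Assume that $p<1/2$, and that for a given $\delta>0$, $\alpha_{\min}>(\log n)^{(\delta-3)/4}$ and $$\frac{(\alpha_{\min}\log n)^4}{p\,n^{\alpha_{\min}}}\to0\quad\text{as }n\to\infty.$$ Then $$\limsup_{n\to\infty}\|E\|_2\le 2\mu\,(p\,n^{\alpha_{\min}})^{-1/2}\quad\text{almost surely.}$$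
   Context: $\|\cdot\|_2$ denotes the spectral norm of a matrix, $\|x\|_\infty=\max_i|x_i|$ for a vector $x$, and $\circ$ denotes the entrywise (Hadamard) product. *)

(* Defs.v *)
From HB Require Import structures.
From mathcomp Require Import all_boot all_order all_algebra.
From mathcomp Require Import all_classical all_reals all_analysis.
Set Implicit Arguments. Unset Strict Implicit. Unset Printing Implicit Defensive.
Import Order.TTheory GRing.Theory Num.Theory.
Import numFieldNormedType.Exports.
Local Open Scope classical_set_scope.
Local Open Scope ring_scope.

Definition norm2 {R : realType} {n : nat} (x : 'cV[R]_n) : R :=
  Num.sqrt (\sum_(i < n) x i 0 ^+ 2).

Definition spec_norm {R : realType} {m n : nat} (A : 'M[R]_(m, n)) : R :=
  sup [set norm2 (A *m x) | x in [set x : 'cV[R]_n | norm2 x <= 1]].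

Definition norm_inf {R : realType} {n : nat} (x : 'cV[R]_n) : R :=
  \big[Num.max/0]_(i < n) `|x i 0|.

Definition card_supp {R : realType} {n : nat} (x : 'cV[R]_n) : nat :=
  #|[set i : 'I_n | x i 0 != 0]|.

Definition hadamard {R : realType} {m n : nat} (A B : 'M[R]_(m, n)) : 'M[R]_(m, n) :=
  \matrix_(i, j) (A i j * B i j).

Definition mutually_independent {R : realType} {d : measure_display}
  {T : measurableType d} (P : probability T R) {I : finType}
  (X : I -> T -> R) : Prop :=
  forall (F : {set I}) (B : I -> set R), (forall i, measurable (B i)) ->
    fine (P (\bigcap_(i in [set i | i \in F]) (X i @^-1` B i))) =
    \prod_(i in F) fine (P (X i @^-1` B i)).

Definition coherence {R : realType} {n : nat} (lam : 'I_n -> R)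
  (u : 'I_n -> 'cV[R]_n) (alpha : 'I_n -> R) : R :=
  \sum_(i < n) `|lam i| * (n%:R `^ alpha i) * norm_inf (u i) ^+ 2.

(* alpha_min = min_i alpha_i (for n = 0, the empty min is set to 1; irrelevant). *)
Definition alpha_min {R : realType} {n : nat} (alpha : 'I_n -> R) : R :=
  \big[Num.min/1]_(i < n) alpha i.

(* Main.v *)
(** Write E as the sum over l of lambda_l D_l X D_l, with D_l = diag(u_l) and X = Q - 1
    restricted to the support of u_l, a set of at most N_l = n^alpha_l indices. It suffices
    that, almost surely, ||X|| <= 2 (1 + o(1)) sqrt(N_l / p) for all l and all large n.

    The entries of X are sigma * xi_e, one centred normalised variable for each edge e, with
    xi_e^2 = 1 + c * xi_e, so the products of the xi_e over finite edge sets S (the Walsh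
    functions) are orthonormal. In this basis, multiplication by X toggles an edge of S and
    adds a term c [e in S]. On coefficients of degree at most d, Schur's test bounds the
    creation of an edge at an untouched vertex by sqrt N (at most N targets, a single source),
    the creation of other edges by 2 (d + 1), and the diagonal term by c sqrt(2 d), its
    Frobenius norm; annihilation is the transpose of creation. Starting from degree 0, this
    bounds the expected squared Hilbert-Schmidt norm of X^k by
    N (sigma (2 sqrt N + 4 k + c sqrt(2 k)))^(2 k). With k of order log n, Markov's inequality,
    a union bound over l and the Borel-Cantelli lemma conclude. *)

Require Import Defs.
From HB Require Import structures.
From mathcomp Require Import all_boot all_order all_algebra.
From mathcomp Require Import all_classical all_reals all_analysis.
From mathcomp Require Import ring lra.
Import Order.TTheory GRing.Theory Num.Theory.
Import numFieldNormedType.Exports.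
Local Open Scope ring_scope.

Set Implicit Arguments.
Unset Strict Implicit.
Unset Printing Implicit Defensive.

(** * Finite-dimensional l2 estimates *)

Section FiniteL2.
Context {R : rcfType}.
Implicit Types I J : finType.

(** Lagrange's identity: the difference of the two sides is half a sum of squares. *)
Lemma sqr_sum_mul_le I (A : pred I) (a b : I -> R) :
  (\sum_(i | A i) a i * b i) ^+ 2 <=
  (\sum_(i | A i) a i ^+ 2) * (\sum_(i | A i) b i ^+ 2).
Proof.
rewrite -subr_ge0.
have -> : (\sum_(i | A i) a i ^+ 2) * (\sum_(i | A i) b i ^+ 2) -
    (\sum_(i | A i) a i * b i) ^+ 2 =
    2^-1 * \sum_(i | A i) \sum_(j | A j) (a i * b j - a j * b i) ^+ 2.
  have E : \sum_(i | A i) \sum_(j | A j) (a i * b j - a j * b i) ^+ 2 =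
     \sum_(i | A i) \sum_(j | A j) a i ^+ 2 * b j ^+ 2
     + \sum_(i | A i) \sum_(j | A j) a j ^+ 2 * b i ^+ 2
     - 2 * \sum_(i | A i) \sum_(j | A j) (a i * b i) * (a j * b j).
    rewrite mulr_sumr -big_split -sumrB; apply: eq_bigr => i _ /=.
    rewrite mulr_sumr -big_split -sumrB; apply: eq_bigr => j _ /=; ring.
  rewrite {}E [X in _ + X - _]exchange_big /=.
  have S (f g : I -> R) : \sum_(i | A i) \sum_(j | A j) f i * g j =
      (\sum_(i | A i) f i) * (\sum_(i | A i) g i).
    by rewrite mulr_suml; apply: eq_bigr => i _; rewrite mulr_sumr.
  by rewrite !S; field.
by rewrite mulr_ge0 ?invr_ge0 // sumr_ge0 // => i _; rewrite sumr_ge0 // => j _;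
  rewrite sqr_ge0.
Qed.

Definition l2norm I (f : I -> R) : R := Num.sqrt (\sum_i f i ^+ 2).

Lemma l2norm_ge0 I (f : I -> R) : 0 <= l2norm f.
Proof. exact: sqrtr_ge0. Qed.

Lemma sqr_l2norm I (f : I -> R) : l2norm f ^+ 2 = \sum_i f i ^+ 2.
Proof. by rewrite sqr_sqrtr // sumr_ge0 // => i _; rewrite sqr_ge0. Qed.

Lemma normr_le_of_sqr (x y : R) : 0 <= y -> x ^+ 2 <= y ^+ 2 -> `|x| <= y.
Proof. by move=> y0; rewrite -[x ^+ 2]real_normK ?num_real // ler_sqr ?nnegrE. Qed.

Lemma dot_le I (f g : I -> R) : `|\sum_i f i * g i| <= l2norm f * l2norm g.
Proof.
apply: normr_le_of_sqr; first by rewrite mulr_ge0 ?l2norm_ge0.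
by rewrite exprMn !sqr_l2norm; apply: sqr_sum_mul_le.
Qed.

(* Since [A] is 0/1-valued, Cauchy-Schwarz applies to the products of [A F] and [A G]. *)
Lemma schur_test I (A : rel I) (F G : I -> R) (a b C : R) :
    0 <= C -> 0 <= b -> a * b <= C ^+ 2 ->
    (forall x, F x != 0 -> #|[pred y | A x y]|%:R <= a) ->
    (forall y, G y != 0 -> #|[pred x | A x y]|%:R <= b) ->
  `|\sum_x \sum_(y | A x y) F x * G y| <= C * (l2norm F * l2norm G).
Proof.
move=> C0 b0 abC rowA colA; apply: normr_le_of_sqr.
  by rewrite mulr_ge0 ?mulr_ge0 ?l2norm_ge0.
rewrite pair_big_dep /=; apply: le_trans (sqr_sum_mul_le _ _ _) _.
have cst (B : pred I) (x : R) : \sum_(y | B y) x = #|[pred y | B y]|%:R * x.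
  by rewrite sumr_const mulr_natl.
have rowF : \sum_(q | A q.1 q.2) F q.1 ^+ 2 <= a * l2norm F ^+ 2.
  rewrite -(pair_big_dep xpredT A (fun x _ => F x ^+ 2)) sqr_l2norm mulr_sumr.
  apply: ler_sum => x _; rewrite cst; have [->|Fx] := eqVneq (F x) 0.
    by rewrite expr0n !mulr0.
  by rewrite ler_wpM2r ?sqr_ge0 ?rowA.
have colG : \sum_(q | A q.1 q.2) G q.2 ^+ 2 <= b * l2norm G ^+ 2.
  rewrite -(pair_big_dep xpredT A (fun _ y => G y ^+ 2)) (exchange_big_dep xpredT) //=.
  rewrite sqr_l2norm mulr_sumr.
  apply: ler_sum => x _; rewrite cst; have [->|Gx] := eqVneq (G x) 0.
    by rewrite expr0n !mulr0.
  by rewrite ler_wpM2r ?sqr_ge0 ?colA.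
apply: le_trans (ler_pM _ _ rowF colG) _.
- by apply: sumr_ge0 => q _; rewrite sqr_ge0.
- by apply: sumr_ge0 => q _; rewrite sqr_ge0.
rewrite !exprMn mulrACA; apply: ler_wpM2r => //; by rewrite mulr_ge0 ?exprn_ge0 ?l2norm_ge0.
Qed.

(** Matrices are functions here, so that any finite type can index them, in particular the support
    of an eigenvector. *)
Definition fun_mx I (X : I -> I -> R) (v : I -> R) (i : I) : R := \sum_j X i j * v j.

Lemma l2norm_frobenius I (X : I -> I -> R) (v : I -> R) :
  l2norm (fun_mx X v) ^+ 2 <= (\sum_i \sum_j X i j ^+ 2) * l2norm v ^+ 2.
Proof.
rewrite !sqr_l2norm mulr_suml; apply: ler_sum => i _.
exact: sqr_sum_mul_le.
Qed.

(** * Growth of the iterates of a symmetric matrix *)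

Section Symmetric.
Variables (I : finType) (X : I -> I -> R).
Hypothesis symX : forall i j, X i j = X j i.

Lemma fun_mx_sym (v w : I -> R) :
  \sum_i fun_mx X v i * w i = \sum_i v i * fun_mx X w i.
Proof.
rewrite (eq_bigr (fun i => \sum_j v j * (X j i * w i))); last first.
  by move=> i _; rewrite /fun_mx mulr_suml; apply: eq_bigr => j _;
     rewrite symX mulrA [v j * _]mulrC.
by rewrite exchange_big; apply: eq_bigr => i _; rewrite -mulr_sumr.
Qed.

(** Symmetry moves one factor [X] across the inner product of [X^(m+1) v] with itself;
    Cauchy-Schwarz does the rest. *)
Lemma l2norm_iter_logconvex (v : I -> R) m :
  l2norm (iter m.+1 (fun_mx X) v) ^+ 2 <=
  l2norm (iter m (fun_mx X) v) * l2norm (iter m.+2 (fun_mx X) v).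
Proof.
rewrite sqr_l2norm (eq_bigr (fun i => fun_mx X (iter m (fun_mx X) v) i *
  iter m.+1 (fun_mx X) v i)); last by move=> i _; rewrite expr2.
by rewrite fun_mx_sym; apply: le_trans (ler_norm _) (dot_le _ _).
Qed.

(** By log-convexity the ratios of consecutive norms are nondecreasing, so the first is at most the
    one at [m]. The product form allows for vanishing norms. *)
Lemma l2norm_iter_step (v : I -> R) m :
  l2norm (fun_mx X v) * l2norm (iter m (fun_mx X) v) <=
  l2norm v * l2norm (iter m.+1 (fun_mx X) v).
Proof.
elim: m => [|m IHm]; first by rewrite mulrC.
have := l2norm_iter_logconvex v m; set a := l2norm v.
set b := l2norm (fun_mx X v); move: IHm; rewrite -/a -/b.
set x := l2norm (iter m _ v); set y := l2norm (iter m.+1 _ v).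
set z := l2norm (iter m.+2 _ v) => bx yy.
have [a0 b0] : 0 <= a /\ 0 <= b by rewrite !l2norm_ge0.
have [x0 y0] : 0 <= x /\ 0 <= y by rewrite !l2norm_ge0.
have z0 : 0 <= z by rewrite l2norm_ge0.
move: x0; rewrite le_eqVlt => /orP[/eqP xE|x0].
  have /eqP -> : y == 0 by rewrite -sqrf_eq0 eq_le sqr_ge0 andbT (le_trans yy) // -xE mul0r.
  by rewrite mulr0 mulr_ge0.
rewrite -(ler_pM2l x0) mulrA [x * b]mulrC.
apply: le_trans (ler_wpM2r y0 bx) _.
by rewrite -mulrA -expr2 [leRHS]mulrCA ler_wpM2l.
Qed.

(** Telescoping the ratios transfers a bound on [X^k] to [X] without diagonalising. *)
Lemma l2norm_fun_mx_pow (v : I -> R) k :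
  l2norm (fun_mx X v) ^+ k * l2norm v <=
  l2norm v ^+ k * l2norm (iter k (fun_mx X) v).
Proof.
elim: k => [|k IHk]; first by rewrite !expr0.
rewrite !exprS -mulrA; apply: le_trans (ler_wpM2l (l2norm_ge0 _) IHk) _.
rewrite mulrCA [l2norm v * _]mulrC -mulrA.
by rewrite ler_wpM2l ?exprn_ge0 ?l2norm_ge0 // l2norm_iter_step.
Qed.

End Symmetric.

Definition delta1 I (j i : I) : R := (i == j)%:R.

Lemma iter_fun_mx_delta I (X : I -> I -> R) (v : I -> R) k i :
  iter k (fun_mx X) v i = \sum_j v j * iter k (fun_mx X) (delta1 j) i.
Proof.
elim: k i => [|k IHk] i /=.
  rewrite (bigD1 i) //= /delta1 eqxx mulr1 big1 ?addr0 // => j /negPf.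
  by rewrite eq_sym => ->; rewrite mulr0.
rewrite /fun_mx (eq_bigr (fun l => \sum_j X i l * (v j * iter k (fun_mx X) (delta1 j) l))).
  rewrite exchange_big; apply: eq_bigr => j _; rewrite mulr_sumr.
  by apply: eq_bigr => l _; rewrite mulrCA.
by move=> l _; rewrite IHk mulr_sumr.
Qed.

Lemma l2norm_iter_hs I (X : I -> I -> R) (v : I -> R) k :
  l2norm (iter k (fun_mx X) v) ^+ 2 <=
  l2norm v ^+ 2 * \sum_j l2norm (iter k (fun_mx X) (delta1 j)) ^+ 2.
Proof.
rewrite (eq_bigr _ (fun j _ => sqr_l2norm _)) exchange_big /= !sqr_l2norm mulr_sumr.
by apply: ler_sum => i _; rewrite iter_fun_mx_delta; apply: sqr_sum_mul_le.
Qed.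

(* The sum on the right is the squared Hilbert-Schmidt norm of [X^k]. *)
Lemma l2norm_fun_mx_hs I (X : I -> I -> R) (v : I -> R) k :
    (forall i j, X i j = X j i) -> (0 < k)%N ->
  (l2norm (fun_mx X v) ^+ k) ^+ 2 <=
  (l2norm v ^+ k) ^+ 2 * \sum_j l2norm (iter k (fun_mx X) (delta1 j)) ^+ 2.
Proof.
move=> symX k0; have := l2norm_ge0 v; rewrite le_eqVlt => /orP[/eqP v0|v0].
  have /eqP -> : l2norm (fun_mx X v) == 0.
    rewrite -sqrf_eq0 eq_le sqr_ge0 andbT; apply: le_trans (l2norm_frobenius _ _) _.
    by rewrite -v0 expr0n mulr0.
  by rewrite -v0 !expr0n (gtn_eqF k0) expr0n mul0r.
have v2 : 0 < l2norm v ^+ 2 by rewrite exprn_gt0.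
rewrite -(ler_pM2r v2) -exprMn.
apply: (@le_trans _ _ ((l2norm v ^+ k * l2norm (iter k (fun_mx X) v)) ^+ 2)).
  rewrite ler_sqr ?nnegrE ?mulr_ge0 ?exprn_ge0 ?l2norm_ge0 //.
  exact: l2norm_fun_mx_pow.
rewrite exprMn -[leRHS]mulrA ler_wpM2l ?sqr_ge0 // [leRHS]mulrC.
exact: l2norm_iter_hs.
Qed.

End FiniteL2.

(** * Multiplication by a random matrix on Walsh coefficients *)

Section Fock.
Context {R : rcfType} {V E : finType} (ed : V -> V -> E).
Hypothesis ed_sym : forall i j, ed i j = ed j i.
Hypothesis ed_inj : forall i, injective (ed i).
Hypothesis ed_card : forall e, (#|[pred q : V * V | ed q.1 q.2 == e]| <= 2)%N.

(** A vector with random coordinates is encoded by its Walsh coefficients: [F (S, i)] is the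
    coefficient on [S] of coordinate [i]. *)
Local Notation state := ({set E} * V)%type.
Implicit Types (S : {set E}) (x y : state) (F G : state -> R).

Definition toggle (e : E) S : {set E} := if e \in S then S :\ e else e |: S.

Lemma toggleK e : involutive (toggle e).
Proof.
move=> S; rewrite /toggle; have [eS|eS] := boolP (e \in S).
  by rewrite !inE eqxx /= finset.setD1K.
by rewrite !inE eqxx /= finset.setU1K.
Qed.

Lemma card_toggle e S : (#|toggle e S| <= #|S|.+1)%N.
Proof.
rewrite /toggle; case: ifPn => eS; last by rewrite cardsU1 eS.
by rewrite (leq_trans (subset_leq_card (finset.subD1set _ _))).
Qed.

Definition fresh S (i : V) := [forall j, ed i j \notin S].

(* With [b = true] the edge is attached to a vertex that [x.1] does not touch, and [x] can be
   recovered from [y]: these transitions carry the leading term [2 * sqrt N] of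
   [fock_radius]. With [b = false] the number of transitions is bounded by the degree. *)
Definition creates (b : bool) x y :=
  [&& ed x.2 y.2 \notin x.1, y.1 == ed x.2 y.2 |: x.1 & fresh x.1 y.2 == b].

Definition adj S (i j : V) : R := (ed i j \in S)%:R.

(* Action on Walsh coefficients of the matrix with entries [s * xi (ed i j)], where the
   [xi e] are orthonormal and [xi e ^+ 2 = 1 + c * xi e]; see [fock_walsh]. *)
Definition fock (s c : R) F x : R :=
  s * (\sum_j F (toggle (ed x.2 j) x.1, j) +
       c * fun_mx (adj x.1) (fun j => F (x.1, j)) x.2).

Lemma sum_creates x F :
  \sum_(y | creates true x y) F y + \sum_(y | creates false x y) F y =
  \sum_(j | ed x.2 j \notin x.1) F (ed x.2 j |: x.1, j).
Proof.
case: x => S i /=.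
rewrite [RHS](bigID (fresh S)) /=; congr (_ + _).
  rewrite (reindex_onto (fun j => (ed i j |: S, j)) snd) /=.
    by apply: eq_bigl => j; rewrite /creates /= !eqxx andbT eqb_id.
  by move=> [T j] /and3P[/= _ /eqP-> _].
rewrite (reindex_onto (fun j => (ed i j |: S, j)) snd) /=.
  by apply: eq_bigl => j; rewrite /creates /= !eqxx andbT eqbF_neg.
by move=> [T j] /and3P[/= _ /eqP-> _].
Qed.

(** A predecessor of [y] is determined by its vertex: its edge set is [y.1] without the edge joining
    that vertex to [y.2]. *)
Lemma sum_created y F :
  \sum_(x | creates true x y) F x + \sum_(x | creates false x y) F x =
  \sum_(j | ed y.2 j \in y.1) F (y.1 :\ ed y.2 j, j).
Proof.
case: y => S i /=.
have inv b x : creates b x (S, i) ->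
    [/\ ed i x.2 \in S, x.1 = S :\ ed i x.2 & fresh (S :\ ed i x.2) i == b].
  case: x => T j; rewrite /creates /= ed_sym => /and3P[eT /eqP ->].
  by rewrite finset.setU1K // !inE eqxx.
have crE b j : ed i j \in S ->
    creates b (S :\ ed i j, j) (S, i) = (fresh (S :\ ed i j) i == b).
  by move=> eS; rewrite /creates /= ed_sym finset.setD1K // !inE !eqxx.
rewrite [RHS](bigID (fun j => fresh (S :\ ed i j) i)) /=; congr (_ + _).
  rewrite (reindex_onto (fun j => (S :\ ed i j, j)) snd) /=.
    apply: eq_bigl => j; rewrite eqxx andbT; apply/idP/andP => [/inv[]|[eS]] /=.
      by move=> eS _; rewrite eqb_id.
    by rewrite crE // eqb_id.
  by move=> [T j] /inv[/= _ -> _].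
rewrite (reindex_onto (fun j => (S :\ ed i j, j)) snd) /=.
  apply: eq_bigl => j; rewrite eqxx andbT; apply/idP/andP => [/inv[]|[eS]] /=.
    by move=> eS _; rewrite eqbF_neg.
  by rewrite crE // eqbF_neg.
by move=> [T j] /inv[/= _ -> _].
Qed.

(** Removing an edge is a creation read backwards, so the toggling operator is a sum of two 0/1
    relations and their transposes, ready for [schur_test]. *)
Lemma sum_toggle x F :
  \sum_j F (toggle (ed x.2 j) x.1, j) =
  \sum_(y | creates true x y) F y + \sum_(y | creates false x y) F y +
  (\sum_(y | creates true y x) F y + \sum_(y | creates false y x) F y).
Proof.
rewrite sum_creates sum_created (bigID (fun j => ed x.2 j \notin x.1)) /=.
congr (_ + _); first by apply: eq_bigr => j; rewrite /toggle => /negPf ->.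
by apply: eq_big => j; rewrite negbK // /toggle => ->.
Qed.

Lemma creates_row x : (#|[pred y | creates true x y]| <= #|V|)%N.
Proof.
rewrite -(@card_in_image _ _ snd) ?max_card // => -[S i] [T j].
by rewrite !inE => /and3P[/= _ /eqP -> _] /and3P[/= _ /eqP -> _] ->.
Qed.

(** If two predecessors had vertices [i] and [j] with [i != j], the edge from [j] to [y.2] would
    already lie in the edge set of the first, so [y.2] would not be fresh there. *)
Lemma creates_col y : (#|[pred x | creates true x y]| <= 1)%N.
Proof.
apply/card_le1_eqP => -[S i] [T j]; rewrite !inE /creates /= !eqb_id.
move=> /and3P[iS /eqP yS frS] /and3P[jT /eqP yT frT].
have ij : i = j.
  have : ed j y.2 \in y.1 by rewrite yT !inE eqxx.
  rewrite yS !inE => /orP[/eqP|]; first by rewrite !(ed_sym _ y.2) => /ed_inj ->.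
  by rewrite ed_sym (negPf (forallP frS j)).
by subst j; congr (_, _); rewrite -(finset.setU1K iS) -(finset.setU1K jT) -yS -yT.
Qed.

Lemma card_ends S : (#|[pred q : V * V | ed q.1 q.2 \in S]| <= 2 * #|S|)%N.
Proof.
rewrite -[leqLHS]sum1_card (partition_big (fun q => ed q.1 q.2) (fun e => e \in S)) //=.
rewrite mulnC -sum_nat_const; apply: leq_sum => e eS.
rewrite sum1_card; apply: leq_trans (ed_card e); apply: subset_leq_card.
by apply/fintype.subsetP => q; rewrite !inE => /andP[].
Qed.

(** The new vertex is an endpoint of an edge of [x.1]. *)
Lemma recreates_row x : (#|[pred y | creates false x y]| <= 2 * #|x.1|)%N.
Proof.
rewrite -(@card_in_image _ _ snd); last first.
  move=> [S i] [T j].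
  by rewrite !inE => /and3P[/= _ /eqP -> _] /and3P[/= _ /eqP -> _] ->.
apply: leq_trans (card_ends x.1).
apply: leq_trans (leq_image_card fst _); apply: subset_leq_card.
apply/fintype.subsetP => j /fintype.imageP[[T i]]; rewrite inE /creates /= eqbF_neg.
move=> /and3P[_ _ /forallPn[k]]; rewrite negbK => ikS ->.
by apply/fintype.imageP; exists (i, k).
Qed.

(** A predecessor is determined by the edge to remove from [y.1], since [ed_inj] recovers its
    vertex. *)
Lemma recreates_col y : (#|[pred x | creates false x y]| <= #|y.1|)%N.
Proof.
rewrite -(@card_in_image _ _ (fun x => ed x.2 y.2)); last first.
  move=> [S i] [T j]; rewrite !inE => /and3P[/= iS /eqP yS _] /and3P[/= jT /eqP yT _] ee.
  have ij : i = j by apply: (@ed_inj y.2); rewrite !(ed_sym y.2).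
  by subst j; congr (_, _); rewrite -(finset.setU1K iS) -(finset.setU1K jT) -yS -yT.
apply: subset_leq_card; apply/fintype.subsetP => e /fintype.imageP[[S i]].
by rewrite inE => /and3P[/= _ /eqP -> _] ->; rewrite !inE eqxx.
Qed.

Lemma frobenius_adj S : \sum_i \sum_j adj S i j ^+ 2 <= (2 * #|S|)%:R.
Proof.
rewrite pair_bigA /=.
rewrite (eq_bigr (fun q : V * V => if ed q.1 q.2 \in S then 1 else 0)); last first.
  by move=> q _; rewrite /adj; case: (_ \in S); rewrite ?expr1n ?expr0n.
rewrite -big_mkcond sumr_const ler_nat; exact: card_ends.
Qed.

(** The diagonal term preserves [S], so it acts separately on each fibre, as the matrix [adj S],
    whose norm is at most its Frobenius norm. *)
Lemma adj_bound F D : (forall x, F x != 0 -> (#|x.1| <= D)%N) ->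
  l2norm (fun x => fun_mx (adj x.1) (fun j => F (x.1, j)) x.2) <=
  Num.sqrt (2 * D)%:R * l2norm F.
Proof.
move=> supF.
rewrite -(@ler_sqr R) ?nnegrE ?mulr_ge0 ?l2norm_ge0 ?sqrtr_ge0 //.
rewrite exprMn !sqr_l2norm sqr_sqrtr ?ler0n //.
rewrite -(pair_bigA _ (fun S i => fun_mx (adj S) (fun j => F (S, j)) i ^+ 2)) /=.
rewrite [X in _ * X](eq_bigr (fun x => F (x.1, x.2) ^+ 2)); last by case.
rewrite -(pair_bigA _ (fun S i => F (S, i) ^+ 2)) /= mulr_sumr.
apply: ler_sum => S _.
have [/existsP[i Fi]|/existsPn F0] := boolP [exists i, F (S, i) != 0].
  have := l2norm_frobenius (adj S) (fun j => F (S, j)).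
  rewrite !sqr_l2norm => /le_trans; apply; rewrite ler_wpM2r //.
    by apply: sumr_ge0 => j _; rewrite sqr_ge0.
  by apply: le_trans (frobenius_adj S) _; rewrite ler_nat leq_mul2l (supF _ Fi).
rewrite big1 ?mulr_ge0 ?ler0n //; first by apply: sumr_ge0 => j _; rewrite sqr_ge0.
move=> i _; rewrite /fun_mx big1 ?expr0n // => j _.
by have := F0 j; rewrite negbK => /eqP ->; rewrite mulr0.
Qed.

Lemma fock_support s c F d : (forall x, F x != 0 -> (#|x.1| <= d)%N) ->
  forall x, fock s c F x != 0 -> (#|x.1| <= d.+1)%N.
Proof.
move=> supF x; apply: contraNT; rewrite -ltnNge => dx.
have F0 y : (d < #|y.1|)%N -> F y = 0.
  by move=> dy; apply/eqP; apply: contraTT dy; rewrite -leqNgt => /supF.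
rewrite /fock /fun_mx !big1 ?mulr0 ?addr0 ?mulr0 // => j _.
  by rewrite F0 ?mulr0 //= ltnW.
by rewrite F0 //= -ltnS; apply: leq_trans dx _; rewrite -{1}(toggleK (ed x.2 j) x.1) card_toggle.
Qed.

(** The three terms bound, in order, creation at fresh vertices with its transpose, the other
    creations with theirs, and the diagonal term. *)
Definition fock_radius (s c N : R) (D : nat) : R :=
  s * (2 * Num.sqrt N + 4 * D%:R + c * Num.sqrt (2 * D)%:R).

Lemma fock_radius_ge0 (s c N : R) D : 0 <= s -> 0 <= c -> 0 <= fock_radius s c N D.
Proof. by move=> s0 c0; rewrite /fock_radius mulr_ge0 // !addr_ge0 ?mulr_ge0 ?sqrtr_ge0. Qed.

(** The squared norm of the image [G] is the inner product of [G] with [fock s c F]. It splits into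
    four creation sums, bounded by Schur's test, and a diagonal sum. The strict degree bound on [F]
    leaves degree at most [D] for [G]. *)
Lemma fock_bound (s c N : R) D F : 0 <= s -> 0 <= c -> #|V|%:R <= N ->
    (forall x, F x != 0 -> (#|x.1| < D)%N) ->
  l2norm (fock s c F) <= fock_radius s c N D * l2norm F.
Proof.
move=> s0 c0 VN supF; set G := fock s c F.
have supG x : G x != 0 -> (#|x.1| <= D)%N.
  (* For [D = 0] the support hypothesis forces [F = 0], hence [G = 0]. *)
  case: D supF => [|D] supF; last exact: fock_support.
  by move=> Gx; exfalso; move: Gx; rewrite /G /fock /fun_mx !big1 ?mulr0 ?addr0 ?mulr0 ?eqxx // => j _;
    [have [->|/supF] := eqVneq (F (x.1, j)) 0|
     have [->|/supF] := eqVneq (F (toggle (ed x.2 j) x.1, j)) 0]; rewrite ?mulr0.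
have supF' x : F x != 0 -> (#|x.1| <= D)%N by move/supF/ltnW.
have N0 : 0 <= N by apply: le_trans VN; rewrite ler0n.
have fresh_bound (H K : state -> R) : `|\sum_x \sum_(y | creates true x y) H x * K y| <=
    Num.sqrt N * (l2norm H * l2norm K).
  apply: (@schur_test _ _ _ _ _ N 1); rewrite ?sqrtr_ge0 ?mulr1 ?sqr_sqrtr //.
    by move=> x _; apply: le_trans VN; rewrite ler_nat creates_row.
  by move=> x _; rewrite lern1 creates_col.
have old_bound (H K : state -> R) : (forall x, H x != 0 -> (#|x.1| <= D)%N) ->
    (forall x, K x != 0 -> (#|x.1| <= D)%N) ->
    `|\sum_x \sum_(y | creates false x y) H x * K y| <=
    (2 * D)%:R * (l2norm H * l2norm K).
  move=> supH supK; apply: (@schur_test _ _ _ _ _ (2 * D)%:R D%:R); rewrite ?ler0n //.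
  - by rewrite -natrM -natrX ler_nat expnMn -mulnA leq_mul // mulnn leq_pmull.
  - move=> x /supH xD; rewrite ler_nat; apply: leq_trans (recreates_row x) _.
    by rewrite leq_mul2l xD.
  - by move=> x /supK xD; rewrite ler_nat; apply: leq_trans (recreates_col x) _.
have GE : l2norm G ^+ 2 = s * (
    \sum_x \sum_(y | creates true x y) G x * F y +
    \sum_x \sum_(y | creates false x y) G x * F y +
    (\sum_x \sum_(y | creates true x y) F x * G y +
     \sum_x \sum_(y | creates false x y) F x * G y) +
    c * \sum_x fun_mx (adj x.1) (fun j => F (x.1, j)) x.2 * G x).
  have exch b : \sum_x \sum_(y | creates b x y) F x * G y =
      \sum_x \sum_(y | creates b y x) F y * G x.
    by rewrite (exchange_big_dep xpredT).
  rewrite sqr_l2norm !exch.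
  rewrite -!big_split mulr_sumr -big_split mulr_sumr; apply: eq_bigr => x _ /=.
  rewrite expr2 {1}/G /fock sum_toggle.
  by rewrite -!mulr_sumr -!mulr_suml; ring.
have F0 := l2norm_ge0 F; have := l2norm_ge0 G.
rewrite le_eqVlt => /orP[/eqP <-|G0].
  by rewrite mulr_ge0 // fock_radius_ge0.
rewrite -(ler_pM2r G0) -expr2 GE /fock_radius -!mulrA ler_wpM2l // .
have b1 := le_trans (ler_norm _) (fresh_bound G F).
have b2 := le_trans (ler_norm _) (old_bound G F supG supF').
have b3 := le_trans (ler_norm _) (fresh_bound F G).
have b4 := le_trans (ler_norm _) (old_bound F G supF' supG).
have b5 : c * \sum_x fun_mx (adj x.1) (fun j => F (x.1, j)) x.2 * G x <=
    c * (Num.sqrt (2 * D)%:R * (l2norm F * l2norm G)).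
  rewrite ler_wpM2l //; apply: le_trans (ler_norm _) _; apply: le_trans (dot_le _ _) _.
  by rewrite mulrA ler_wpM2r ?l2norm_ge0 ?adj_bound.
rewrite mulrCA in b1; rewrite [l2norm G * _]mulrC in b1 b2.
apply: le_trans (lerD (lerD (lerD b1 b2) (lerD b3 b4)) b5) _.
by rewrite natrM; lra.
Qed.

Lemma fock_iter_bound (s c N : R) D (x0 : state) : 0 <= s -> 0 <= c -> #|V|%:R <= N ->
    x0.1 = finset.set0 ->
  l2norm (iter D (fock s c) (delta1 x0)) <= fock_radius s c N D ^+ D.
Proof.
move=> s0 c0 VN x00.
have rad0 := fock_radius_ge0 N D s0 c0.
have sup m x : iter m (fock s c) (delta1 x0) x != 0 -> (#|x.1| <= m)%N.
  elim: m x => [|m IHm]; last exact: fock_support.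
  move=> x; rewrite /= /delta1 pnatr_eq0 eqb0 negbK => /eqP ->.
  by rewrite x00 cards0.
(* Only the number of steps varies in the induction; the radius stays at [D], which is valid because
   fewer than [D] steps give degree below [D]. *)
have : (D <= D)%N by []; elim: {1 3 5}D => [_|m IHm mD] /=.
  rewrite expr0 /l2norm (bigD1 x0) //= big1 ?addr0.
    by rewrite /delta1 eqxx expr1n sqrtr1.
  by move=> x /negPf xx0; rewrite /delta1 xx0 expr0n.
rewrite exprS; apply: le_trans (fock_bound s0 c0 VN _) _.
  by move=> x /sup xm; apply: leq_ltn_trans xm mD.
by rewrite ler_wpM2l // IHm // ltnW.
Qed.

End Fock.

(** * Walsh functions and the tail of the operator norm *)

Section Walsh.
Context {R : rcfType} {E : finType} (p : R).
Hypothesis p01 : 0 < p < 1.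
Implicit Types (S T : {set E}) (f : {ffun E -> bool}).

Let p0 : 0 < p. Proof. by case/andP: p01. Qed.
Let q0 : 0 < 1 - p. Proof. by case/andP: p01; rewrite subr_gt0. Qed.

(** [sdev] is the standard deviation of an entry of the mask, [centred] its normalised value, and
    [skew] the third moment of [centred], written [c] in [fock]. *)
Definition sdev : R := Num.sqrt ((1 - p) / p).
Definition skew : R := sdev - sdev^-1.
Definition centred (b : bool) : R := if b then sdev else - sdev^-1.
Definition bern (b : bool) : R := if b then p else 1 - p.
Definition weight f : R := \prod_e bern (f e).
Definition walsh S f : R := \prod_(e in S) centred (f e).

Lemma sdev_gt0 : 0 < sdev.
Proof. by rewrite sqrtr_gt0 divr_gt0. Qed.

Lemma sqr_sdev : sdev ^+ 2 = (1 - p) / p.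
Proof. by rewrite sqr_sqrtr // ltW // divr_gt0. Qed.

Lemma sdev_centred b : sdev * centred b = b%:R / p - 1.
Proof.
have s0 := lt0r_neq0 sdev_gt0; have pN0 := lt0r_neq0 p0.
case: b => /=; first by rewrite -expr2 sqr_sdev; field.
by rewrite mulrN divff // mul0r sub0r.
Qed.

(** The two values have product [-1] and sum [skew], so both are roots of [X^2 = 1 + skew * X]. *)
Lemma sqr_centred b : centred b ^+ 2 = 1 + skew * centred b.
Proof.
have s0 := lt0r_neq0 sdev_gt0.
by rewrite /skew; case: b => /=; field.
Qed.

Lemma centred_mean : p * centred true + (1 - p) * centred false = 0.
Proof.
have s0 := lt0r_neq0 sdev_gt0; have pN0 := lt0r_neq0 p0.
apply: (mulfI s0); rewrite mulrDr mulr0 !(mulrCA sdev) !sdev_centred /=; field.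
exact: pN0.
Qed.

Lemma weight_ge0 f : 0 <= weight f.
Proof. by apply: prodr_ge0 => e _; rewrite /bern; case: (f e); rewrite ltW. Qed.

Lemma sum_bern (g : bool -> R) :
  \sum_b bern b * g b = p * g true + (1 - p) * g false.
Proof. by rewrite big_bool. Qed.

(** The expectation factors over edges: an edge in both sets or in neither contributes 1, an edge in
    exactly one contributes the zero mean. *)
Lemma walsh_orthonormal S T :
  \sum_f weight f * (walsh S f * walsh T f) = (S == T)%:R.
Proof.
pose h (U : {set E}) e b := if e \in U then centred b else 1.
have -> : \sum_f weight f * (walsh S f * walsh T f) =
    \prod_e \sum_b bern b * (h S e b * h T e b).
  rewrite bigA_distr_bigA; apply: eq_bigr => f _.
  by rewrite /walsh !(big_mkcond (fun e => e \in _)) -!big_split.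
have one e : (e \in S) = (e \in T) -> \sum_b bern b * (h S e b * h T e b) = 1.
  move=> ST; rewrite sum_bern /h -ST; case: (e \in S); last by ring.
  rewrite -!expr2 !sqr_centred.
  transitivity (1 + skew * (p * centred true + (1 - p) * centred false)); first by ring.
  by rewrite centred_mean mulr0 addr0.
have zero e : (e \in S) != (e \in T) -> \sum_b bern b * (h S e b * h T e b) = 0.
  by rewrite sum_bern /h; case: (e \in S); case: (e \in T) => // _;
    rewrite ?mul1r ?mulr1 centred_mean.
have [ST|/eqP ST] := eqVneq S T; first by rewrite big1 // => e _; rewrite one ?ST.
have [e eST] : exists e, (e \in S) != (e \in T).
  apply/existsP; apply: contra_notT ST => /existsPn ST.
  by apply/finset.setP => e; apply/eqP; have := ST e; rewrite negbK.
by rewrite (bigD1 e) //= zero ?mul0r.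
Qed.

Lemma walsh_parseval (a : {set E} -> R) :
  \sum_f weight f * (\sum_S a S * walsh S f) ^+ 2 = \sum_S a S ^+ 2.
Proof.
transitivity (\sum_f \sum_S \sum_T a S * a T * (weight f * (walsh S f * walsh T f))).
  apply: eq_bigr => f _; rewrite expr2 mulr_suml mulr_sumr; apply: eq_bigr => S _.
  by rewrite !mulr_sumr; apply: eq_bigr => T _; ring.
rewrite exchange_big; apply: eq_bigr => S _; rewrite exchange_big (bigD1 S) //=.
rewrite -mulr_sumr walsh_orthonormal eqxx mulr1 -expr2 big1 ?addr0 // => T TS.
by rewrite -mulr_sumr walsh_orthonormal eq_sym (negPf TS) mulr0.
Qed.

Lemma centred_walsh e S f :
  centred (f e) * walsh S f = walsh (toggle e S) f + skew * (e \in S)%:R * walsh S f.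
Proof.
rewrite /toggle; case: ifPn => eS.
  have -> : walsh S f = centred (f e) * walsh (S :\ e) f.
    by rewrite /walsh (big_setD1 e).
  by rewrite mulrA -expr2 sqr_centred /= mulr1; ring.
by rewrite /walsh big_setU1 //= mulr0 mul0r addr0.
Qed.

(** * Moments of the sampled matrix through its Walsh coefficients *)

Section SampledMatrix.
Context {V : finType} (ed : V -> V -> E).
Hypothesis ed_sym : forall i j, ed i j = ed j i.
Hypothesis ed_inj : forall i, injective (ed i).
Hypothesis ed_card : forall e, (#|[pred q : V * V | ed q.1 q.2 == e]| <= 2)%N.

Definition sampled f i j : R := (f (ed i j))%:R / p - 1.

Lemma fock_walsh (F : {set E} * V -> R) f i :
  fun_mx (sampled f) (fun j => \sum_S F (S, j) * walsh S f) i =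
  \sum_S fock ed sdev skew F (S, i) * walsh S f.
Proof.
rewrite /fun_mx /fock.
transitivity (\sum_j \sum_S sdev * (F (toggle (ed i j) S, j) * walsh S f +
    skew * ((ed i j \in S)%:R * F (S, j)) * walsh S f)).
  apply: eq_bigr => j _; rewrite /sampled -sdev_centred -mulr_sumr -mulrA.
  congr (_ * _); rewrite big_split /=.
  (* Since [toggle] is an involution, reindexing moves it from the coefficient to the Walsh
     function, where [centred_walsh] applies. *)
  rewrite [in RHS](reindex_inj (inv_inj (toggleK (ed i j)))) /= -big_split mulr_sumr.
  apply: eq_bigr => S _ /=; rewrite toggleK mulrCA centred_walsh; ring.
rewrite exchange_big; apply: eq_bigr => S _ /=.
by rewrite -mulr_sumr big_split /= -!mulr_suml -mulr_sumr -mulrDl mulrA.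
Qed.

(** The starting vector is deterministic, so its only Walsh coefficient sits at the empty set, that
    is, in degree 0. *)
Lemma iter_fock_walsh k f j i :
  iter k (fun_mx (sampled f)) (delta1 j) i =
  \sum_S iter k (fock ed sdev skew) (delta1 (finset.set0, j)) (S, i) * walsh S f.
Proof.
elim: k i => [|k IHk] i.
  rewrite (bigD1 finset.set0) //= big1 ?addr0.
    by rewrite /delta1 xpair_eqE eqxx /walsh big_set0 mulr1.
  by move=> S /negPf S0; rewrite /delta1 xpair_eqE S0 mul0r.
rewrite !iterS -fock_walsh; apply: eq_bigr => l _; congr (_ * _); exact: IHk.
Qed.

(** Parseval turns the expected squared norm of each column of the [k]-th power into the norm
    bounded by [fock_iter_bound]; there are at most [N] columns. *)
Lemma expectation_hs (N : R) k : 0 <= skew -> #|V|%:R <= N ->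
  \sum_f weight f * \sum_j l2norm (iter k (fun_mx (sampled f)) (delta1 j)) ^+ 2 <=
  N * (fock_radius sdev skew N k ^+ k) ^+ 2.
Proof.
move=> c0 VN.
rewrite (eq_bigr (fun f => \sum_j \sum_i weight f *
  (\sum_S iter k (fock ed sdev skew) (delta1 (finset.set0, j)) (S, i) * walsh S f) ^+ 2)).
  rewrite exchange_big /=.
  apply: (@le_trans _ _ (\sum_(j : V) (fock_radius sdev skew N k ^+ k) ^+ 2)).
    apply: ler_sum => j _; rewrite exchange_big /=.
    rewrite (eq_bigr _ (fun i _ => walsh_parseval _)).
    rewrite exchange_big pair_bigA /=.
    rewrite (eq_bigr (fun x =>
      iter k (fock ed sdev skew) (delta1 (finset.set0, j)) x ^+ 2)); last by case.
    have s0 := ltW sdev_gt0.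
    rewrite -sqr_l2norm ler_sqr ?nnegrE ?l2norm_ge0 ?exprn_ge0 ?fock_radius_ge0 //.
    exact: (fock_iter_bound ed_sym ed_inj ed_card k s0 c0 VN).
  rewrite sumr_const -mulr_natl ler_wpM2r ?sqr_ge0 //.
move=> f _; rewrite mulr_sumr; apply: eq_bigr => j _.
by rewrite sqr_l2norm mulr_sumr; apply: eq_bigr => i _; rewrite iter_fock_walsh.
Qed.

(** Markov's inequality: a vector stretched by more than [t] forces, by [l2norm_fun_mx_hs], a
    squared Hilbert-Schmidt norm of the [k]-th power above [t ^ (2 k)]. *)
Lemma sampled_tail (N t : R) k : 0 <= skew -> #|V|%:R <= N -> 0 < t -> (0 < k)%N ->
  \sum_(f | `[< exists v, t * l2norm v < l2norm (fun_mx (sampled f) v) >]) weight f <=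
  N * ((fock_radius sdev skew N k / t) ^+ k) ^+ 2.
Proof.
move=> c0 VN t0 k0.
rewrite expr_div_n expr_div_n mulrA ler_pdivlMr ?exprn_gt0 //.
apply: le_trans (expectation_hs k c0 VN).
rewrite mulr_suml [leRHS](bigID (fun f => `[< exists v, t * l2norm v < l2norm (fun_mx (sampled f) v) >])) /=.
rewrite -[leLHS]addr0 lerD //; last first.
  apply: sumr_ge0 => f _; rewrite mulr_ge0 ?weight_ge0 // sumr_ge0 // => j _.
  by rewrite sqr_ge0.
apply: ler_sum => f /asboolP[v vt]; rewrite ler_wpM2l ?weight_ge0 //.
have symX i j : sampled f i j = sampled f j i by rewrite /sampled ed_sym.
have := l2norm_fun_mx_hs v symX k0.
have : ((t * l2norm v) ^+ k) ^+ 2 < (l2norm (fun_mx (sampled f) v) ^+ k) ^+ 2.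
  have tv0 : 0 <= t * l2norm v by rewrite mulr_ge0 ?l2norm_ge0 // ltW.
  have lt2 m (a b : R) : (0 < m)%N -> 0 <= a -> a < b -> a ^+ m < b ^+ m.
    by move=> m0 a0 ab; rewrite ltr_pXn2r ?nnegrE // (le_trans a0) // ltW.
  by apply: (@lt2) => //; [rewrite exprn_ge0 | apply: (@lt2)].
move=> /lt_le_trans/[apply]; rewrite exprMn exprMn [ltLHS]mulrC.
have [->|v0] := eqVneq (l2norm v) 0.
  by rewrite expr0n (gtn_eqF k0) expr0n ?mulr0 ?mul0r ltxx.
have v1 : 0 < l2norm v by rewrite lt_def v0 l2norm_ge0.
by rewrite ltr_pM2l ?exprn_gt0 //; apply: ltW.
Qed.

End SampledMatrix.
End Walsh.

(** * Spectral components and the sampling mask *)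

Section SupportGraph.
Context {n : nat}.

(** Unordered pairs, loops included, in the same encoding as the index type of the independence
    hypothesis. *)
Definition edges : finType := {ij : 'I_n * 'I_n | (ij.1 <= ij.2)%N}.

Lemma edge_subproof (i j : 'I_n) :
  let ij := if (i <= j)%N then (i, j) else (j, i) in (ij.1 <= ij.2)%N.
Proof. by case: leqP => //= /ltnW. Qed.

Definition edge (i j : 'I_n) : edges :=
  exist (fun ij : 'I_n * 'I_n => (ij.1 <= ij.2)%N) _ (edge_subproof i j).

Lemma edge_sym i j : edge i j = edge j i.
Proof.
apply: val_inj => /=; case: (ltngtP i j) => // ij.
by have -> : i = j by apply: val_inj.
Qed.

Lemma edge_inj i : injective (edge i).
Proof.
move=> j k /(congr1 val) /=.
by case: (leqP i j); case: (leqP i k) => ? ? [] //; congruence.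
Qed.

Lemma card_edge_fiber (V : finType) (h : V -> 'I_n) (e : edges) : injective h ->
  (#|[pred q : V * V | edge (h q.1) (h q.2) == e]| <= 2)%N.
Proof.
move=> h_inj; rewrite -(@card_in_image _ _ (fun q => (h q.1, h q.2))); last first.
  by move=> [i j] [k l] _ _ [/= /h_inj -> /h_inj ->].
case: e => -[a b] ab.
apply: (@leq_trans #|[set (a, b); (b, a)]|); last by rewrite cards2; case: (_ != _).
apply: subset_leq_card; apply/fintype.subsetP => q /fintype.imageP[[i j]].
rewrite inE => /eqP/(congr1 val) /= eij ->; rewrite !inE.
by move: eij; case: leqP => _ [<- <-]; rewrite eqxx ?orbT.
Qed.

End SupportGraph.
Arguments edges : clear implicits.

Section SpectralNorm.
Context {R : realType}.

Definition supp n (x : 'cV[R]_n) : finType := {i : 'I_n | x i 0 != 0}.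

Lemma card_suppE n (x : 'cV[R]_n) : #|supp x| = card_supp x.
Proof.
rewrite card_sig; apply: eq_card => i.
by apply/idP/idP => [ui|/set_mem//]; apply: mem_set.
Qed.

Lemma sum_supp n (x : 'cV[R]_n) (g : 'I_n -> R) :
  (forall i, x i 0 = 0 -> g i = 0) -> \sum_i g i = \sum_(i : supp x) g (val i).
Proof.
move=> g0; rewrite (bigID (fun i => x i 0 != 0)) /= [X in _ + X]big1 ?addr0.
  exact: (big_sub [pred i | x i 0 != 0]).
by move=> i; rewrite negbK => /eqP/g0.
Qed.

Lemma norm2E n (x : 'cV[R]_n) : norm2 x = l2norm (fun i => x i 0).
Proof. by []. Qed.

Lemma le_norm_inf n (x : 'cV[R]_n) i : `|x i 0| <= norm_inf x.
Proof. exact: (le_bigmax _ (fun i => `|x i 0|)). Qed.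

Lemma norm_inf_ge0 n (x : 'cV[R]_n) : 0 <= norm_inf x.
Proof. exact: bigmax_ge_id. Qed.

(** Applied on both sides of a spectral component, this produces the squared [norm_inf] of the
    coherence. *)
Lemma l2norm_scale_supp n (x y : 'cV[R]_n) :
  l2norm (fun i : supp x => x (val i) 0 * y (val i) 0) <= norm_inf x * norm2 y.
Proof.
rewrite -ler_sqr ?nnegrE ?mulr_ge0 ?l2norm_ge0 ?norm_inf_ge0 //.
rewrite exprMn norm2E !sqr_l2norm mulr_sumr.
rewrite -(sum_supp (x := x) (g := fun i => (x i 0 * y i 0) ^+ 2)); last first.
  by move=> i ->; rewrite mul0r expr0n.
apply: ler_sum => i _; rewrite exprMn ler_wpM2r ?sqr_ge0 //.
rewrite -[x i 0 ^+ 2]real_normK ?num_real // ler_sqr ?nnegrE ?norm_inf_ge0 //.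
exact: le_norm_inf.
Qed.

(** Test the bilinear bound with [y = A x] and divide by the norm of [A x]. *)
Lemma spec_norm_le n (A : 'M[R]_n) (C : R) : 0 <= C ->
  (forall x y : 'cV[R]_n, \sum_i y i 0 * (A *m x) i 0 <= C * (norm2 y * norm2 x)) ->
  spec_norm A <= C.
Proof.
move=> C0 bilin; apply: ge_sup.
  by exists (norm2 (A *m 0)), 0 => //=; rewrite norm2E /l2norm big1 ?sqrtr0 // => i _;
    rewrite mxE expr0n.
move=> _ [x /= x1 <-].
have := bilin x (A *m x).
have -> : \sum_i (A *m x) i 0 * (A *m x) i 0 = norm2 (A *m x) ^+ 2.
  by rewrite norm2E sqr_l2norm; apply: eq_bigr => i _; rewrite expr2.
have [-> //|yN0] := eqVneq (norm2 (A *m x)) 0.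
have y0 : 0 < norm2 (A *m x) by rewrite lt_def yN0 [leRHS]norm2E l2norm_ge0.
rewrite expr2 mulrCA ler_pM2l // => /le_trans; apply.
by rewrite -[leRHS]mulr1 ler_wpM2l.
Qed.

(* The mask acts on each spectral component [lam l *: (u l *m (u l)^T)] as the sampled
   matrix on the support of [u l], scaled on both sides by the entries of [u l]. *)
Lemma spec_norm_sampling_error n (M Q : 'M[R]_n) (lam : 'I_n -> R)
    (u : 'I_n -> 'cV[R]_n) (p : R) (f : {ffun edges n -> bool}) (t : 'I_n -> R) :
    M = \sum_(l < n) lam l *: (u l *m (u l)^T) ->
    (forall i j, Q i j = (f (edge i j))%:R / p) ->
    (forall l, 0 <= t l) ->
    (forall l (v : supp (u l) -> R),
      l2norm (fun_mx (sampled p (fun i j : supp (u l) => edge (val i) (val j)) f) v)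
      <= t l * l2norm v) ->
  spec_norm (hadamard M Q - M) <= \sum_l `|lam l| * t l * norm_inf (u l) ^+ 2.
Proof.
move=> ME QE t0 Xt; apply: spec_norm_le => [|x y].
  by apply: sumr_ge0 => l _; rewrite !mulr_ge0 ?exprn_ge0 ?norm_inf_ge0.
pose X := sampled p edge f.
have -> : \sum_i y i 0 * ((hadamard M Q - M) *m x) i 0 =
    \sum_l lam l * \sum_i (u l i 0 * y i 0) * \sum_j X i j * (u l j 0 * x j 0).
  under [RHS]eq_bigr do rewrite mulr_sumr.
  rewrite exchange_big; apply: eq_bigr => i _ /=; rewrite mxE.
  transitivity (\sum_j \sum_l
     lam l * (u l i 0 * y i 0 * (X i j * (u l j 0 * x j 0)))).
    rewrite mulr_sumr; apply: eq_bigr => j _.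
    rewrite !mxE QE ME summxE -[X in _ - X]mulr1 -mulrBr.
    rewrite mulrA [y i 0 * _]mulrC mulr_suml -mulrA mulr_suml.
    apply: eq_bigr => l _; rewrite !mxE big_ord1 !mxE /X /sampled; ring.
  rewrite exchange_big; apply: eq_bigr => l _; rewrite !mulr_sumr.
  by [].
rewrite mulr_suml; apply: ler_sum => l _.
apply: le_trans (ler_norm _) _; rewrite normrM -!mulrA ler_wpM2l //.
(* The vectors scaled by [u l] vanish off its support, so both sums restrict to it. *)
rewrite (sum_supp (x := u l)); last by move=> i ->; rewrite !mul0r.
set Y := fun_mx (sampled p (fun i j : supp (u l) => edge (val i) (val j)) f)
  (fun j => u l (val j) 0 * x (val j) 0).
rewrite (eq_bigr (fun i : supp (u l) => u l (val i) 0 * y (val i) 0 * Y i)); last first.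
  move=> i _; congr (_ * _); rewrite (sum_supp (x := u l)) // => j ->.
  by rewrite mul0r mulr0.
apply: le_trans (dot_le _ _) _.
apply: le_trans (ler_pM (l2norm_ge0 _) (l2norm_ge0 _) (l2norm_scale_supp _ _) (Xt l _)) _.
apply: le_trans (ler_wpM2l _ (ler_wpM2l (t0 l) (l2norm_scale_supp _ _))) _.
  by rewrite mulr_ge0 ?norm_inf_ge0 ?l2norm_ge0.
by rewrite le_eqVlt; apply/orP; left; apply/eqP; ring.
Qed.

End SpectralNorm.

(** * The radius compared with its leading term *)

Section RadiusAsymptotics.
Context {R : rcfType}.

(** Below [1 / 2] the variance [(1 - p) / p] is at least 1. *)
Lemma skew_ge0 (p : R) : 0 < p < 1 -> p < 1 / 2 -> 0 <= skew p.
Proof.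
move=> p01 p2; have s0 := sdev_gt0 p01; case/andP: p01 => p0 p1.
have s1 : 1 <= sdev p.
  by rewrite /sdev -[leLHS]sqrtr1 ler_wsqrtr // ler_pdivlMr //; lra.
by rewrite /skew subr_ge0 (le_trans _ s1) // invf_le1.
Qed.

(** With [sdev <= p^(-1/2)] and [sdev * skew <= 1 / p], each of the two lower-order terms is at most
    [eps * sqrt (N / p)]. *)
Lemma fock_radius_le (p N eps : R) k : 0 < p < 1 -> 0 <= N -> 0 < eps ->
    (4 * k%:R) ^+ 2 <= eps ^+ 2 * N -> (2 * k)%:R <= eps ^+ 2 * (p * N) ->
  fock_radius (sdev p) (skew p) N k <= 2 * (1 + eps) * Num.sqrt (N / p).
Proof.
move=> p01 N0 e0 kN kpN; have s0 := sdev_gt0 p01.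
have ss := sqr_sdev p01; case/andP: (p01) => p0 p1.
have pi0 : 0 < p^-1 by rewrite invr_gt0.
set r := Num.sqrt p^-1.
have r0 : 0 < r by rewrite sqrtr_gt0.
have rr : r ^+ 2 = p^-1 by rewrite sqr_sqrtr // ltW.
have sr : sdev p <= r.
  by rewrite ler_wsqrtr // ler_pdivrMr // mulVf ?lt0r_neq0 //; lra.
have scr : sdev p * skew p <= r ^+ 2.
  rewrite /skew mulrBr divff ?lt0r_neq0 // -expr2 ss rr.
  by rewrite mulrBl divff ?lt0r_neq0 // mul1r; lra.
have qN : Num.sqrt (N / p) = r * Num.sqrt N by rewrite mulrC sqrtrM // ltW.
have n0 := sqrtr_ge0 N; have [e0' r0' s0'] := And3 (ltW e0) (ltW r0) (ltW s0).
have b1 : 4 * k%:R <= eps * Num.sqrt N.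
  by rewrite -ler_sqr ?nnegrE ?mulr_ge0 // [leRHS]exprMn sqr_sqrtr.
have b2 : Num.sqrt (2 * k)%:R * r <= eps * Num.sqrt N.
  rewrite -ler_sqr ?nnegrE ?mulr_ge0 ?sqrtr_ge0 // !exprMn rr !sqr_sqrtr //.
  by rewrite ler_pdivrMr // -mulrA [N * p]mulrC.
rewrite qN /fock_radius !mulrDr.
have c1 : sdev p * (2 * Num.sqrt N) <= r * (2 * Num.sqrt N).
  by rewrite ler_wpM2r ?mulr_ge0.
have c2 : sdev p * (4 * k%:R) <= r * (eps * Num.sqrt N).
  by apply: ler_pM; rewrite ?mulr_ge0.
have c3 : sdev p * (skew p * Num.sqrt (2 * k)%:R) <= r * (eps * Num.sqrt N).
  rewrite mulrA; apply: le_trans (ler_wpM2r (sqrtr_ge0 _) scr) _.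
  by rewrite expr2 -mulrA [r * Num.sqrt _]mulrC ler_wpM2l.
apply: le_trans (lerD (lerD c1 c2) c3) _.
by rewrite le_eqVlt; apply/orP; left; apply/eqP; ring.
Qed.

End RadiusAsymptotics.

(** * From the product space to the given probability space *)

Section SampledEvent.
Local Open Scope classical_set_scope.
Context {R : realType} {d : measure_display} {T : measurableType d}.
Context (P : probability T R) {n : nat} (p : R) (Q : T -> 'M[R]_n).
Hypothesis p01 : 0 < p < 1.
Hypothesis measQ : forall i j, measurable_fun setT (fun w => Q w i j).
Hypothesis symQ : forall i j w, Q w i j = Q w j i.
Hypothesis Q1 : forall i j, P [set w | Q w i j = p^-1] = p%:E.
Hypothesis Q0 : forall i j, P [set w | Q w i j = 0] = (1 - p)%:E.
Hypothesis indepQ : mutually_independent P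
  (fun k : {ij : 'I_n * 'I_n | (ij.1 <= ij.2)%N} => fun w => Q w (sval k).1 (sval k).2).
Implicit Types f : {ffun edges n -> bool}.

Definition cylinder f : set T :=
  \bigcap_(e in [set e | e \in [set: edges n]%SET])
    (fun w => Q w (sval e).1 (sval e).2) @^-1` [set (f e)%:R / p].

Lemma measurable_cylinder f : measurable (cylinder f).
Proof.
apply: fin_bigcap_measurable; first exact: finite_finset.
by move=> e _; rewrite -[X in measurable X]setTI; apply: measQ => //; exact: measurable_set1.
Qed.

Lemma cylinder_prob f : P (cylinder f) = (weight p f)%:E.
Proof.
rewrite -[LHS]fineK ?fin_num_measure //; last exact: measurable_cylinder.
rewrite (indepQ [set: edges n]%SET (B := fun e => [set (f e)%:R / p])); last first.
  by move=> e; exact: measurable_set1.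
congr EFin; rewrite /weight; apply: eq_big => [e|e _]; first by rewrite finset.in_setT.
rewrite /bern; case: (f e) => /=.
  by rewrite mul1r [X in fine (P X)](_ : _ = [set w | Q w (val e).1 (val e).2 = p^-1]) ?Q1.
by rewrite mul0r [X in fine (P X)](_ : _ = [set w | Q w (val e).1 (val e).2 = 0]) ?Q0.
Qed.

Lemma cylinder_inj f g w : cylinder f w -> cylinder g w -> f = g.
Proof.
move=> fw gw; apply/ffunP => e; have pN0 : p^-1 != 0.
  by case/andP: p01 => p0 _; rewrite invr_eq0 lt0r_neq0.
have := fw e; have := gw e; rewrite /= finset.in_setT => /(_ isT) -> /(_ isT).
by move/(mulIf pN0)/eqP; rewrite eqr_nat; case: (f e); case: (g e).
Qed.

Lemma cylinder_entries f w : cylinder f w -> forall i j, Q w i j = (f (edge i j))%:R / p.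
Proof.
move=> fw i j; have := fw (edge i j); rewrite /= finset.in_setT => /(_ isT) <-.
by case: leqP => //= _.
Qed.

Lemma sum_weight : \sum_(f : {ffun edges n -> bool}) weight p f = 1.
Proof.
have := @walsh_orthonormal R (edges n) p p01 finset.set0 finset.set0.
rewrite eqxx => H; apply: etrans H; apply: eq_bigr => f _.
by rewrite /walsh big_set0 !mulr1.
Qed.

(** [A] is the complement of the good cylinders, so it also absorbs the null event where [Q] takes
    other values than 0 and [1 / p]. *)
Lemma sampling_event (bad : pred {ffun edges n -> bool}) :
  exists A, [/\ measurable A, P A = (\sum_(f | bad f) weight p f)%:E &
    forall w, ~ A w ->
      exists2 f, ~~ bad f & forall i j, Q w i j = (f (edge i j))%:R / p].
Proof.
pose G := \bigcup_(f in [set` predC bad]) cylinder f.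
have finG : finite_set [set` predC bad] by exact: finite_finpred.
have mG : measurable G.
  by apply: fin_bigcup_measurable => // f _; exact: measurable_cylinder.
exists (~` G); split; first exact: measurableC.
  rewrite probability_setC // measure_fin_bigcup //; last 2 first.
  - by move=> f g _ _ [w [fw gw]]; exact: cylinder_inj fw gw.
  - by move=> f _; exact: measurable_cylinder.
  rewrite (eq_fsbigr (fun f => (weight p f)%:E)); last by move=> f _; exact: cylinder_prob.
  rewrite -(bigfs _ (index_enum_uniq _)); last by move=> f _; rewrite mem_index_enum.
  by rewrite sumEFin -EFinB -sum_weight (bigID bad) /= addrK.
move=> w /contrapT[f /= fgood fw]; exists f => //.
exact: cylinder_entries.
Qed.

(** One factor [n] comes from the union bound over eigenvectors, the other from [N l <= n] in
    [sampled_tail]. Of the two factors [1 + eps] in the threshold, one covers the radius and the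
    other gives the decay in [k]. *)
Lemma sampling_deviation (u : 'I_n -> 'cV[R]_n) (N : 'I_n -> R) (eps : R) k :
    p < 1 / 2 -> 0 < eps -> (0 < k)%N ->
    (forall l, (card_supp (u l))%:R <= N l) -> (forall l, 1 <= N l <= n%:R) ->
    (forall l, (4 * k%:R) ^+ 2 <= eps ^+ 2 * N l) ->
    (forall l, (2 * k)%:R <= eps ^+ 2 * (p * N l)) ->
  exists A, [/\ measurable A, (P A <= (n%:R ^+ 2 / ((1 + eps) ^+ k) ^+ 2)%:E)%E &
    forall w, ~ A w -> exists2 f : {ffun edges n -> bool},
      forall l (v : supp (u l) -> R),
        l2norm (fun_mx (sampled p (fun i j : supp (u l) => edge (val i) (val j)) f) v)
        <= 2 * (1 + eps) ^+ 2 * Num.sqrt (N l / p) * l2norm v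
      & forall i j, Q w i j = (f (edge i j))%:R / p].
Proof.
move=> p2 e0 k0 cardN N1 kN kpN.
pose t l := 2 * (1 + eps) ^+ 2 * Num.sqrt (N l / p).
pose X l f := fun_mx (sampled p (fun i j : supp (u l) => edge (val i) (val j)) f).
pose badl l f := `[< exists v, t l * l2norm v < l2norm (X l f v) >].
have [A [mA PA hA]] := sampling_event [pred f | [exists l, badl l f]].
exists A; split=> // [|w /hA[f fgood fQ]]; last first.
  exists f => // l v; rewrite leNgt; apply: contra fgood => vbad.
  by apply/existsP; exists l; apply/asboolP; exists v.
rewrite PA lee_fin.
have e1 : 0 < 1 + eps by rewrite addr_gt0.
have badl_weight l : \sum_(f | badl l f) weight p f <= n%:R / ((1 + eps) ^+ k) ^+ 2.
  have /andP[Nl1 Nln] := N1 l.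
  have N0 : 0 < N l by apply: lt_le_trans Nl1.
  have [p0 _] := andP p01.
  have sN : 0 < Num.sqrt (N l / p) by rewrite sqrtr_gt0 divr_gt0.
  have t0 : 0 < t l by rewrite !mulr_gt0 ?exprn_gt0.
  apply: (@le_trans _ _ (N l *
     ((fock_radius (sdev p) (skew p) (N l) k / t l) ^+ k) ^+ 2)).
    apply: sampled_tail => //.
    - by move=> i j; exact: edge_sym.
    - by move=> i j j' /edge_inj/val_inj.
    - by move=> e; apply: card_edge_fiber; exact: val_inj.
    - exact: skew_ge0.
    - by rewrite card_suppE.
  apply: ler_pM => //; first exact: ltW.
    by rewrite sqr_ge0.
  rewrite -!exprVn.
  have r0 : 0 <= fock_radius (sdev p) (skew p) (N l) k / t l.
    rewrite divr_ge0 ?(ltW t0) // fock_radius_ge0 ?skew_ge0 //.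
    by rewrite ltW // sdev_gt0.
  have rt : fock_radius (sdev p) (skew p) (N l) k / t l <= (1 + eps)^-1.
    rewrite ler_pdivrMr //; apply: le_trans (fock_radius_le p01 (ltW N0) e0 (kN l) (kpN l)) _.
    rewrite /t le_eqVlt; apply/orP; left; apply/eqP.
    by field; rewrite lt0r_neq0.
  by rewrite !lerXn2r ?nnegrE ?exprn_ge0 ?invr_ge0 ?(ltW e1).
apply: (@le_trans _ _ (\sum_l \sum_(f | badl l f) weight p f)).
  rewrite (exchange_big_dep xpredT) //= big_mkcond /=; apply: ler_sum => f _.
  have w0 := weight_ge0 p01 f.
  case: ifPn => [/existsP[l fl]|_]; last by apply: sumr_ge0.
  by rewrite (bigD1 l) //= lerDl sumr_ge0.
apply: le_trans (ler_sum _ (fun l _ => badl_weight l)) _.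
by rewrite sumr_const card_ord -mulrnAl -mulr_natl -expr2.
Qed.

End SampledEvent.

(** * Asymptotics and almost sure convergence *)

Section Asymptotics.
Local Open Scope classical_set_scope.
Context {R : realType}.

(** Chosen so that [(1 + eps) ^ k >= n ^ 2], which brings the failure probability below the summable
    [1 / n ^ 2]. *)
Definition moment_order (eps : R) (n : nat) : nat :=
  (Num.truncn (2 * ln n%:R / ln (1 + eps))).+1.

Lemma ln_natr_ge (K : R) : \forall n \near \oo, K <= ln (n%:R : R).
Proof.
near=> n; rewrite -ler_expR lnK.
  near: n; exact: nbhs_infty_ger.
by rewrite posrE ltr0n; near: n; exact: nbhs_infty_gt.
Unshelve. all: by end_near. Qed.

(** A single term of the exponential series; the exponent is one more than the power [y ^ 8] to be
    absorbed in [moment_order_small]. *)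
Lemma pow9_le_expR (x : R) : 0 <= x -> x ^+ 9 <= 9`!%:R * expR x.
Proof.
move=> x0; rewrite mulrC -ler_pdivrMr ?ltr0n ?fact_gt0 //.
by apply: le_trans (expR_ge1Dxn 8 x0); rewrite lerDr.
Qed.

Lemma moment_order_large (eps : R) n : 0 < eps -> (0 < n)%N ->
  n%:R ^+ 2 / ((1 + eps) ^+ moment_order eps n) ^+ 2 <= (n%:R ^+ 2)^-1 :> R.
Proof.
move=> e0 n0; have e1 : 0 < 1 + eps by rewrite addr_gt0.
have l0 : 0 < ln (1 + eps) by rewrite ln_gt0 // ltrDl.
have nR : 0 < n%:R :> R by rewrite ltr0n.
have nk : n%:R ^+ 2 <= (1 + eps) ^+ moment_order eps n.
  rewrite -ler_ln ?posrE ?exprn_gt0 // !lnXn // -[leLHS]mulr_natl -[leRHS]mulr_natl.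
  by rewrite -ler_pdivrMr //; apply/ltW/truncnS_gt.
rewrite ler_pdivrMr ?exprn_gt0 // mulrC ler_pdivlMr ?exprn_gt0 // -expr2.
by rewrite lerXn2r ?nnegrE ?exprn_ge0 ?(ltW e1).
Qed.

Lemma moment_order_le (eps : R) n : 0 < eps -> 1 <= ln (n%:R : R) ->
  (moment_order eps n)%:R <= (2 / ln (1 + eps) + 1) * ln (n%:R : R).
Proof.
move=> e0 L1; have l0 : 0 < ln (1 + eps) by rewrite ln_gt0 // ltrDl.
rewrite /moment_order -[leLHS]natr1 [leRHS]mulrDl mul1r lerD //.
have x0 : 0 <= 2 * ln (n%:R : R) / ln (1 + eps).
  by rewrite divr_ge0 ?(ltW l0) // mulr_ge0 // (le_trans _ L1).
by apply: (@le_trans _ _ (2 * ln (n%:R : R) / ln (1 + eps)));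
  [rewrite truncn_le | rewrite mulrAC].
Qed.

(** Put [y = a n * ln n], so that [n ^ a = exp y]. The lower bound on [a] gives [ln n <= y ^ 4],
    hence [k <= C * y ^ 4]. The first estimate then holds because [exp y] beats [y ^ 8], the second
    because [y ^ 4 / (p n ^ a)] tends to 0. *)
Lemma moment_order_small (p a : nat -> R) (delta eps : R) :
    (forall n, 0 < p n) -> 0 < eps -> 0 < delta ->
    (\forall n \near \oo, ln (n%:R : R) `^ ((delta - 3) / 4) < a n) ->
    (fun n : nat => (a n * ln (n%:R : R)) ^+ 4 / (p n * n%:R `^ a n)) @ \oo --> (0 : R) ->
  \forall n \near \oo, [/\ (0 < n)%N,
    (4 * (moment_order eps n)%:R) ^+ 2 <= eps ^+ 2 * n%:R `^ a n &
    (2 * moment_order eps n)%:R <= eps ^+ 2 * (p n * n%:R `^ a n)].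
Proof.
move=> p0 e0 d0 a_large cv0.
pose C : R := 2 / ln (1 + eps) + 1.
have l0 : 0 < ln (1 + eps) by rewrite ln_gt0 // ltrDl.
have C0 : 0 < C by rewrite addr_gt0 // divr_gt0.
have e2 : 0 < eps ^+ 2 by rewrite exprn_gt0.
pose K : R := 16 * C ^+ 2 * 9`!%:R / eps ^+ 2.
have K0 : 0 <= K by rewrite divr_ge0 ?mulr_ge0 ?(ltW e0) ?(ltW C0) // ltW.
have eta0 : 0 < eps ^+ 2 / (2 * C) by rewrite divr_gt0 // mulr_gt0.
near=> n.
have n0 : (0 < n)%N by near: n; exact: nbhs_infty_gt.
have L1 : 1 <= ln (n%:R : R) by near: n; exact: ln_natr_ge.
have LK : K ^+ 4 <= ln (n%:R : R) by near: n; exact: ln_natr_ge.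
have an : ln (n%:R : R) `^ ((delta - 3) / 4) < a n by near: n.
have Dn : `|(a n * ln (n%:R : R)) ^+ 4 / (p n * n%:R `^ a n)| <= eps ^+ 2 / (2 * C).
  by near: n; exact: (cvgr0_norm_le _ cv0).
have kC := moment_order_le e0 L1; rewrite -/C in kC.
set k := moment_order eps n in kC *; set L := ln (n%:R : R) in L1 LK an Dn kC *.
have nR : 0 < n%:R :> R by rewrite ltr0n.
have L0 : 0 < L by apply: lt_le_trans L1.
have a0 : 0 < a n by apply: le_lt_trans an; exact: powR_ge0.
have [y yE] : exists y, y = a n * L by exists (a n * L).
have y0 : 0 < y by rewrite yE mulr_gt0.
rewrite -yE in Dn.
have yL : L <= y ^+ 4.
  have : (L `^ ((delta - 3) / 4)) ^+ 4 <= a n ^+ 4.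
    by rewrite lerXn2r ?nnegrE ?powR_ge0 ?(ltW a0) ?(ltW an).
  rewrite -powR_mulrn ?powR_ge0 // -powRrM divfK ?pnatr_eq0 // => aL.
  rewrite yE exprMn; apply: le_trans (ler_wpM2r (exprn_ge0 4 (ltW L0)) aL).
  rewrite -powR_mulrn ?(ltW L0) // -powRD; last by rewrite (gt_eqF L0) implybT.
  (* The exponent is [(delta - 3) + 4], which is at least 1. *)
  by rewrite -[leLHS]powRr1 ?(ltW L0) // ler_powR //; lra.
have nE : n%:R `^ a n = expR y by rewrite yE /powR gt_eqF.
have D0 : 0 < p n * n%:R `^ a n by rewrite mulr_gt0 ?powR_gt0.
split=> //; last first.
  move: Dn; rewrite ger0_norm; last by rewrite divr_ge0 ?(ltW D0) // exprn_ge0 // (ltW y0).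
  rewrite ler_pdivrMr // => /(le_trans yL) LD.
  rewrite natrM; apply: (@le_trans _ _ (2 * C * L)).
    by rewrite -mulrA ler_wpM2l.
  apply: le_trans (ler_wpM2l _ LD) _; first by rewrite mulr_ge0 // ltW.
  rewrite le_eqVlt; apply/orP; left; apply/eqP.
  by field; rewrite gt_eqF.
rewrite nE.
have yK : K <= y.
  rewrite -(@ler_pXn2r _ 4) ?nnegrE ?(ltW y0) //.
  exact: le_trans yL.
have k2 : (4 * k%:R) ^+ 2 <= 16 * C ^+ 2 * y ^+ 8.
  apply: (@le_trans _ _ ((4 * (C * y ^+ 4)) ^+ 2)).
    have kCy : k%:R <= C * y ^+ 4 by rewrite (le_trans kC) // ler_wpM2l // ltW.
    rewrite ler_pXn2r ?nnegrE ?mulr_ge0 ?exprn_ge0 ?(ltW C0) ?(ltW y0) //.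
    by rewrite ler_pM2l.
  by rewrite le_eqVlt; apply/orP; left; apply/eqP; ring.
apply: (le_trans k2).
have f0 : 0 < 9`!%:R :> R by rewrite ltr0n fact_gt0.
rewrite -(ler_pM2l f0) [leRHS]mulrCA; apply: le_trans (ler_wpM2l (ltW e2) (pow9_le_expR (ltW y0))).
have -> : 9`!%:R * (16 * C ^+ 2 * y ^+ 8) = eps ^+ 2 * (K * y ^+ 8).
  by rewrite /K; field; rewrite gt_eqF.
by rewrite ler_wpM2l ?(ltW e2) // [leRHS]exprS ler_wpM2r ?exprn_ge0 // ltW.
Unshelve. all: by end_near. Qed.

Lemma limn_esup_le_near (v : nat -> \bar R) (x : \bar R) :
  (\forall n \near \oo, (v n <= x)%E) -> (limn_esup v <= x)%E.
Proof.
move=> vx; apply: (@le_trans _ _ (ereal_sup (v @` [set n | (v n <= x)%E]))).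
  by apply: ereal_inf_lbound; exists [set n | (v n <= x)%E].
by apply: ge_ereal_sup => _ [n nx <-].
Qed.

(** Telescoping comparison: [1 / n ^ 2 <= 6 / ((n + 1) (n + 2))], with equality at [n = 1]. *)
Lemma sum_inv_sqr_lty (v : nat -> \bar R) : (forall n, 0 <= v n)%E -> v 0 = 0%E ->
  (forall n, (0 < n)%N -> (v n <= ((n%:R ^+ 2)^-1)%:E)%E) ->
  (\sum_(n <oo) v n < +oo)%E.
Proof.
move=> v0 v00 vn; apply: (@le_lt_trans _ _ 6%:E); last exact: ltry.
apply: lime_le; first by apply: is_cvg_nneseries => n _ _.
apply: nearW => m; apply: (@le_trans _ _ (6 - 6 / m.+1%:R)%:E); last first.
  by rewrite lee_fin gerBl divr_ge0.
elim: m => [|m IHm]; first by rewrite big_geq // divr1 subrr.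
rewrite big_nat_recr //=; apply: le_trans (leeD IHm (_ : _ <= (6 / (m.+1%:R * m.+2%:R))%:E)%E) _.
  case: m {IHm} => [|m]; first by rewrite v00 lee_fin divr_ge0 // mulr_ge0.
  apply: le_trans (vn _ _) _ => //; rewrite lee_fin.
  rewrite ler_pdivlMr ?mulr_gt0 ?ltr0n // ler_pdivrMl ?exprn_gt0 ?ltr0n //.
  have := ler0n R m; rewrite -!natr1; nra.
rewrite -EFinD lee_fin le_eqVlt; apply/orP; left; apply/eqP; field.
by rewrite -!natr1 !gt_eqF // ?ltr_wpDl.
Qed.

End Asymptotics.

Section AlmostSure.
Local Open Scope classical_set_scope.
Context {R : realType}.

Lemma alpha_min_le n (alpha : 'I_n -> R) i : alpha_min alpha <= alpha i.
Proof. exact: bigmin_le_cond. Qed.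

(** The scaling turns [sqrt (n ^ alpha_l / p)] into the geometric mean of [n ^ alpha_l] and
    [n ^ alpha_min], at most [n ^ alpha_l]; what remains is the coherence. *)
Lemma spec_norm_scaled n (lam alpha : 'I_n -> R) (u : 'I_n -> 'cV[R]_n)
    (M Q : 'M[R]_n) (p mu eps : R) (f : {ffun edges n -> bool}) :
    (0 < n)%N -> 0 < p -> 0 < eps ->
    M = \sum_(l < n) lam l *: (u l *m (u l)^T) ->
    coherence lam u alpha <= mu ->
    (forall l (v : supp (u l) -> R),
      l2norm (fun_mx (sampled p (fun i j : supp (u l) => edge (val i) (val j)) f) v)
      <= 2 * (1 + eps) ^+ 2 * Num.sqrt (n%:R `^ alpha l / p) * l2norm v) ->
    (forall i j, Q i j = (f (edge i j))%:R / p) ->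
  spec_norm (hadamard M Q - M) * Num.sqrt (p * n%:R `^ alpha_min alpha)
  <= 2 * (1 + eps) ^+ 2 * mu.
Proof.
move=> n0 p0 e0 ME cohmu devf Qf.
have c0 : 0 <= 2 * (1 + eps) ^+ 2 by rewrite mulr_ge0 // sqr_ge0.
have nR : 1 <= n%:R :> R by rewrite ler1n.
have nP a : 0 < n%:R `^ a :> R by rewrite powR_gt0 // (lt_le_trans _ nR).
have t0 l : 0 <= 2 * (1 + eps) ^+ 2 * Num.sqrt (n%:R `^ alpha l / p).
  by rewrite mulr_ge0 ?sqrtr_ge0.
apply: le_trans (ler_wpM2r (sqrtr_ge0 _) (spec_norm_sampling_error ME Qf t0 devf)) _.
apply: le_trans (ler_wpM2l c0 cohmu); rewrite /coherence mulr_suml mulr_sumr.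
apply: ler_sum => l _.
have sqrt_le : Num.sqrt (n%:R `^ alpha l / p) * Num.sqrt (p * n%:R `^ alpha_min alpha)
    <= n%:R `^ alpha l.
  rewrite -sqrtrM ?divr_ge0 ?(ltW p0) ?(ltW (nP _)) // mulrA divfK ?gt_eqF //.
  rewrite -[leRHS]ger0_norm ?(ltW (nP _)) // -sqrtr_sqr ler_wsqrtr // expr2.
  by rewrite ler_pM2l // ler_powR // alpha_min_le.
set c := 2 * _; set s1 := Num.sqrt _ in sqrt_le *; set s2 := Num.sqrt _ in sqrt_le *.
have -> : `|lam l| * (c * s1) * norm_inf (u l) ^+ 2 * s2 =
  c * (`|lam l| * (s1 * s2) * norm_inf (u l) ^+ 2) by ring.
by rewrite ler_wpM2l // ler_wpM2r ?sqr_ge0 // ler_wpM2l.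
Qed.

Lemma borel_cantelli_inv_sqr d (T : measurableType d) (P : probability T R)
    (A : nat -> set T) n0 :
    (forall n, measurable (A n)) ->
    (forall n, (n0 <= n)%N -> (P (A n) <= ((n%:R ^+ 2)^-1)%:E)%E) -> (0 < n0)%N ->
  {ae P, forall w, \forall n \near \oo, ~ A n w}.
Proof.
(* Events before [n0] carry no bound and are emptied; [B 0] is among them because [n0 > 0]. *)
move=> mA PA n0_gt0; pose B n := if (n0 <= n)%N then A n else set0.
have mB n : measurable (B n) by rewrite /B; case: ifP.
have sumB : (\sum_(n <oo) P (B n) < +oo)%E.
  apply: sum_inv_sqr_lty => // [|n _]; rewrite /B.
    by rewrite leqNgt n0_gt0 measure0.
  by case: ifP => [/PA //|_]; rewrite measure0 lee_fin invr_ge0 sqr_ge0.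
exists (lim_sup_set B); split.
- by apply: bigcap_measurable => // n _; apply: bigcup_measurable.
- exact: lim_sup_set_cvg0.
move=> w /= notev m _; apply: contrapT => wB; apply: notev.
exists (maxn m n0) => // n /=; rewrite geq_max => /andP[mn nn] An.
by apply: wB; exists n => //; rewrite /B nn.
Qed.

Lemma limn_esup_spec_norm d (T : measurableType d) (P : probability T R)
    (v : nat -> T -> R) (mu : R) : 0 <= mu ->
    (forall eps, 0 < eps -> {ae P, forall w, \forall n \near \oo,
       v n w <= 2 * (1 + eps) ^+ 2 * mu}) ->
  {ae P, forall w, (limn_esup (fun n => (v n w)%:E) <= (2 * mu)%:E)%E}.
Proof.
move=> mu0 aev.
have : {ae P, forall w, forall m : nat, \forall n \near \oo,
    v n w <= 2 * (1 + m.+1%:R^-1) ^+ 2 * mu}.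
  by apply: ae_foralln => m; apply: aev; rewrite invr_gt0.
apply: filterS => w vw; apply/lee_addgt0Pr => e e0.
(* With [x = 1 / (m + 1) <= 1], [(1 + x) ^ 2 <= 1 + 3 x], so the excess over [2 mu] is at most
   [6 mu x <= e]. *)
pose m := Num.truncn (6 * mu / e).
apply: (@le_trans _ _ (2 * (1 + m.+1%:R^-1) ^+ 2 * mu)%:E).
  by apply: limn_esup_le_near; apply: filterS (vw m) => n; rewrite lee_fin.
rewrite -EFinD lee_fin.
have m0 : 0 < m.+1%:R :> R by [].
have i0 : 0 < m.+1%:R^-1 :> R by rewrite invr_gt0.
have i1 : m.+1%:R^-1 <= 1 :> R by rewrite invf_le1 // ler1n.
have h : 6 * mu * m.+1%:R^-1 <= e.
  by rewrite ler_pdivrMr // [leRHS]mulrC -ler_pdivrMr //; apply/ltW/truncnS_gt.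
set x := m.+1%:R^-1 in i0 i1 h *.
have : (1 + x) ^+ 2 <= 1 + 3 * x by nra.
by nra.
Qed.

End AlmostSure.

Unset Implicit Arguments.
Local Open Scope classical_set_scope.

Theorem theorem1 (R : realType) (d : measure_display) (T : measurableType d)
  (P : probability T R)
  (M : forall n : nat, 'M[R]_n)
  (lam : forall n : nat, 'I_n -> R)
  (u : forall n : nat, 'I_n -> 'cV[R]_n)
  (p : nat -> R)
  (Q : forall n : nat, T -> 'M[R]_n)
  (alpha : forall n : nat, 'I_n -> R)
  (mu delta : R) :
  (* spectral decomposition with distinct, decreasingly ordered eigenvalues *)
  (forall n, M n = \sum_(i < n) lam n i *: (u n i *m (u n i)^T)) ->
  (forall n (i j : 'I_n), (i < j)%N -> lam n j < lam n i) ->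
  (forall n (i j : 'I_n), (u n i)^T *m u n j = (i == j)%:R%:M) ->
  (* sampling probability *)
  (forall n, 0 < p n < 1) ->
  (forall n, p n < 1 / 2) ->
  (* the random symmetric mask Q *)
  (forall n (i j : 'I_n), measurable_fun setT (fun w => Q n w i j)) ->
  (forall n (i j : 'I_n) w, Q n w i j = Q n w j i) ->
  (forall n (i j : 'I_n), P [set w | Q n w i j = (p n)^-1] = (p n)%:E) ->
  (forall n (i j : 'I_n), P [set w | Q n w i j = 0] = (1 - p n)%:E) ->
  (forall n, mutually_independent P
     (fun k : {ij : 'I_n * 'I_n | (ij.1 <= ij.2)%N} =>
        fun w => Q n w (sval k).1 (sval k).2)) ->
  (* the alpha's *)
  (forall n (i : 'I_n), 0 <= alpha n i <= 1) ->
  (forall n, coherence (lam n) (u n) (alpha n) <= mu) ->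
  (forall n (i : 'I_n), (card_supp (u n i))%:R <= n%:R `^ alpha n i) ->
  0 < delta ->
  (\forall n \near \oo,
     ln (n%:R : R) `^ ((delta - 3) / 4) < alpha_min (alpha n)) ->
  (fun n : nat => (alpha_min (alpha n) * ln (n%:R : R)) ^+ 4
                   / (p n * n%:R `^ alpha_min (alpha n))) @ \oo --> (0 : R) ->
  (* conclusion: limsup ||E||_2 (p n^{alpha_min})^{1/2} <= 2 mu  a.s. *)
  {ae P, forall w,
     (limn_esup (fun n : nat =>
        (spec_norm (hadamard (M n) (Q n w) - M n)
         * Num.sqrt (p n * n%:R `^ alpha_min (alpha n)))%:E)
      <= (2 * mu)%:E)%E}.
Proof.
move=> ME _ _ p01 p2 mQ symQ Q1 Q0 indepQ alpha01 cohmu cardN delta0 a_large cv0.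
(* The coherence is a sum of nonnegative terms, so any index gives [0 <= mu]. *)
apply: limn_esup_spec_norm => [|eps eps0].
  apply: le_trans (cohmu 0%N); apply: sumr_ge0 => i _.
  by rewrite mulr_ge0 ?sqr_ge0 // mulr_ge0 ?powR_ge0.
have p0 n : 0 < p n by case/andP: (p01 n).
have [n1 _ good] := moment_order_small p0 eps0 delta0 a_large cv0.
pose n0 := n1.+1.
(* The bounds are conditional on [n0 <= n], so that an event exists for every [n] and a whole
   sequence can be chosen. *)
have event n : exists A, measurable A /\ ((n0 <= n)%N ->
    (P A <= ((n%:R ^+ 2)^-1)%:E)%E /\
    forall w, ~ A w -> spec_norm (hadamard (M n) (Q n w) - M n)
      * Num.sqrt (p n * n%:R `^ alpha_min (alpha n)) <= 2 * (1 + eps) ^+ 2 * mu).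
  have [nn|_] := leqP n0 n; last by exists set0; split.
  have [n_gt0 kN kpN] := good n (ltnW nn).
  have nR : 1 <= n%:R :> R by rewrite ler1n.
  have minN l : n%:R `^ alpha_min (alpha n) <= n%:R `^ alpha n l :> R.
    by rewrite ler_powR // alpha_min_le.
  have N1 l : 1 <= n%:R `^ alpha n l <= n%:R.
    have /andP[al0 al1] := alpha01 n l.
    rewrite -[X in X <= _ <= _](powRr0 n%:R) ler_powR //=.
    by rewrite -[leRHS]powRr1 ?ler_powR // (le_trans _ nR).
  have e2 : 0 <= eps ^+ 2 by rewrite sqr_ge0.
  have kNl l : (4 * (moment_order eps n)%:R) ^+ 2 <= eps ^+ 2 * n%:R `^ alpha n l.
    by rewrite (le_trans kN) // ler_wpM2l.
  have kpNl l : (2 * moment_order eps n)%:R <= eps ^+ 2 * (p n * n%:R `^ alpha n l).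
    by rewrite (le_trans kpN) // ler_wpM2l // ler_wpM2l // ltW.
  have [A [mA PA hA]] := sampling_deviation (p01 n) (mQ n) (symQ n) (Q1 n) (Q0 n)
    (indepQ n) (p2 n) eps0 (ltn0Sn _) (cardN n) N1 kNl kpNl.
  exists A; split=> // _; split.
    by apply: le_trans PA _; rewrite lee_fin; exact: moment_order_large.
  move=> w /hA[f devf Qf].
  exact: (spec_norm_scaled n_gt0 (p0 n) eps0 (ME n) (cohmu n) devf Qf).
have [A hA] := choice event.
have [|n nn|//|B [mB PB subB]] := @borel_cantelli_inv_sqr R d T P A n0.
- by move=> n; case: (hA n).
- by case: (hA n) => _ /(_ nn)[].
exists B; split=> // w wB; apply: subB => evA; apply: wB.
near=> n; have [_ /(_ _)[]] := hA n; first by near: n; exists n0.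
by move=> _; apply; near: n.
Unshelve. all: by end_near. Qed.
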